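(* Let $\mathcal{G}$ be a connected simple undirected graph with vertex set $V$, let $\mathcal{T}$ be any dissecting tree set for $\mathcal{G}$, and let $v\in V$ be any vertex. Write the $h^*$-polynomial of the symmetric edge polytope $P_{\mathcal{G}}$ as $\sum_i (h^*_{\mathcal{G}})_i x^i$. Then for every $i$, $$(h^*_{\mathcal{G}})_i = |\{T\in \mathcal{T}\mid T \text{ has exactly } i \text{ edges pointing away from } v\}|.$$
   Context: For a vertex $u$, $\mathbf{1}_u$ denotes the corresponding standard basis vector of $\mathbb{R}^V$. The symmetric edge polytope is $P_{\mathcal{G}}=\mathrm{conv}\{\mathbf{1}_u-\mathbf{1}_w,\ \mathbf{1}_w-\mathbf{1}_u \mid uw\in E(\mathcal{G})\}\subset\mathbb{R}^V$. For a directed graph $D$, let $\mathcal{Q}_D=\mathrm{conv}\{\mathbf{1}_h-\mathbf{1}_t \mid \overrightarrow{th}\in E(D)\}$. An oriented spanning tree of $\mathcal{G}$ is a spanning tree of $\mathcal{G}$ in which each edge is given one of its two orientations. A dissecting tree set for $\mathcal{G}$ is a set $\mathcal{T}$ of oriented spanning trees of $\mathcal{G}$ such that the simplices $\mathcal{Q}_T$, $T\in\mathcal{T}$, dissect the boundary of $P_{\mathcal{G}}$, i.e. they have pairwise disjoint relative interiors and their union is the boundary of $P_{\mathcal{G}}$. For a directed tree $T$ and a vertex $v$, an edge $e\in T$ points away from $v$ in $T$ if $v$ lies in the component of $T-e$ containing the tail of $e$. For a $d$-dimensional lattice polytope $P\subset\mathbb{R}^n$ with Ehrhart polynomial $\varepsilon_P(t)=|tP\cap\mathbb{Z}^n|$,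 writing uniquely $\varepsilon_P(t)=\sum_{k=0}^d a_k\binom{t+d-k}{d}$, the $h^*$-polynomial of $P$ is $\sum_{k=0}^d a_k x^k$ (coefficients $a_k=0$ for $k>d$). *)

(* Defs.v *)
From HB Require Import structures.
From mathcomp Require Import all_boot all_order all_algebra finmap.
From mathcomp Require Import all_classical reals.

Set Implicit Arguments.
Unset Strict Implicit.
Unset Printing Implicit Defensive.

Import Order.TTheory GRing.Theory Num.Theory.

Local Open Scope classical_set_scope.
Local Open Scope ring_scope.

(* The space R^V; R^o gives it its vector space structure over R. *)
Definition vertex_space (R : realType) (V : finType) : vectType R :=
  {ffun V -> R^o}.

Section Polytopes.
Variables (R : realType) (V : finType).
Local Notation RV := (vertex_space R V).
Implicit Types (A : set RV) (x y : RV).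

Definition coordinate x (u : V) : R := (x : {ffun V -> R^o}) u.

Definition basis_vec (u : V) : RV := [ffun w => (w == u)%:R : R^o].

Definition conv_hull A : set RV :=
  [set x | exists n (p : 'I_n -> RV) (c : 'I_n -> R),
    [/\ forall i, A (p i), forall i, 0 <= c i, \sum_(i < n) c i = 1
      & x = \sum_(i < n) c i *: p i]].

Definition aff_hull A : set RV :=
  [set x | exists n (p : 'I_n -> RV) (c : 'I_n -> R),
    [/\ forall i, A (p i), \sum_(i < n) c i = 1
      & x = \sum_(i < n) c i *: p i]].

Definition has_dim A (d : nat) : Prop :=
  exists (x0 : RV) (U : {vspace RV}),
    \dim U = d /\ aff_hull A = [set x0 + u | u in [set` U]].

(* Interior relative to the affine hull, for the sup-norm topology of R^V. *)
Definition relint A : set RV :=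
  [set x | A x /\ exists2 eps : R, 0 < eps &
    forall y, aff_hull A y ->
      (forall u, `|coordinate y u - coordinate x u| < eps) -> A y].

(* Only used for polytopes, which are closed, so no closure is taken. The
   boundary has to be relative: symmetric edge polytopes are contained in the
   hyperplane of vectors with coordinate sum 0. *)
Definition relboundary A : set RV := A `\` relint A.

Definition dilate (t : nat) A : set RV := [set t%:R *: x | x in A].

Definition integral_point : set RV :=
  [set x | forall u, coordinate x u \is a Num.int].

(* fset_set is the empty set on infinite sets; the lattice points of a
   dilated polytope are finitely many. *)
Definition ehrhart A (t : nat) : nat :=
  #|` fset_set (dilate t A `&` integral_point)|.

Definition is_hstar A (h : {poly R}) : Prop :=
  exists d : nat,
    [/\ has_dim A d, (size h <= d.+1)%N
      & forall t : nat,
          (ehrhart A t)%:R = \sum_(k < d.+1) h`_k * 'C(t + d - k, d)%:R].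

(* The binomials t |-> 'C(t + d - k, d), k <= d, are linearly independent and
   the dimension of a nonempty A is unique, so at most one polynomial
   satisfies is_hstar A. *)
Definition hstar A : {poly R} := xget 0 (is_hstar A).

Definition symmetric_edge_polytope (e : rel V) : set RV :=
  conv_hull [set x | exists u w, e u w /\
    (x = basis_vec u - basis_vec w \/ x = basis_vec w - basis_vec u)].

(* A directed edge is a pair (tail, head). *)
Definition edge_polytope (D : {set V * V}) : set RV :=
  conv_hull [set basis_vec a.2 - basis_vec a.1 | a in [set` D]].

End Polytopes.

Arguments symmetric_edge_polytope R {V} e.
Arguments edge_polytope R {V} D.

Section OrientedTrees.
Variable V : finType.
Implicit Types (e : rel V) (D T : {set V * V}) (v : V).

Definition underlying D : rel V :=
  [rel x y | ((x, y) \in D) || ((y, x) \in D)].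

(* For an irreflexive symmetric relation, the duplicate-free closed walks of
   length at least 3 are the cycles of the graph. *)
Definition acyclic_graph e : Prop :=
  forall c : seq V, ucycle e c -> (size c < 3)%N.

Definition connected_graph e : Prop := forall x y, connect e x y.

Definition oriented_spanning_tree e T : Prop :=
  [/\ forall x y, (x, y) \in T -> e x y,
      forall x y, (x, y) \in T -> (y, x) \notin T,
      connected_graph (underlying T)
    & acyclic_graph (underlying T)].

Definition points_away T v (a : V * V) : bool :=
  connect (underlying (T :\ a)%SET) a.1 v.

Definition num_away T v : nat := #|[set a in T | points_away T v a]%SET|.

Definition dissecting_tree_set (R : realType) e (TT : {set {set V * V}}) :
    Prop :=
  [/\ forall T, T \in TT -> oriented_spanning_tree e T,
      forall T1 T2, T1 \in TT -> T2 \in TT -> T1 != T2 ->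
        relint (edge_polytope R T1) `&` relint (edge_polytope R T2) = set0
    & \bigcup_(T in [set` TT]) edge_polytope R T
        = relboundary (symmetric_edge_polytope R e)].

End OrientedTrees.

(* Main.v *)
From HB Require Import structures.
Require Import Defs.
From mathcomp Require Import all_boot all_order all_algebra finmap.
From mathcomp Require Import all_classical reals.
From mathcomp Require Import topology normedtype derive.
From mathcomp Require Import lra.

                                                                               
                                                                               
                                                                             
                                                                              
                                                                              
                                                                        
                                                                       
                                                                             
                                                                              
                                                                               
                                                                             
                                                    

Set Implicit Arguments.
Unset Strict Implicit.
Unset Printing Implicit Defensive.

Import Order.TTheory GRing.Theory Num.Theory.
Import numFieldNormedType.Exports.

Local Open Scope classical_set_scope.
Local Open Scope ring_scope.

(** The proof cones over the boundary and counts lattice points in half-open cones. Everything lives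
    in the hyperplane H of vectors with coordinate sum 0. The polytope contains a neighbourhood of 0
    in H ([sep_nbhs0]), so each ray of H from 0 meets its relative boundary exactly once
    ([sep_boundary_ray], [boundary_ray_uniq]). A dissection of the boundary into simplices therefore
    gives a dissection of H into the cones over them.

    For a tree T the edge vectors form a basis of H. The coordinate dual to an edge a is [flow T a],
    the sum of the coordinates over the component of T - a that contains the head of a
    ([tree_decomposition]). Flows of integral points are integers, so the cone of T is unimodular. A
    point of this cone lies in the t-th dilate exactly when its flows sum to at most t
    ([dilate_sepE]).

    The cones overlap along their walls. To separate them, move x by a small positive multiple of q
    = |V| 1_v - sum_u 1_u ([source]). The flow of q along a tree edge is never 0, and it is negative
    exactly when the edge points away from v ([flow_source]). Hence the moved point is off all walls
    and lies in exactly one open cone. In terms of x this means: positive flow on the edges pointing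
    away from v, nonnegative flow on the others. These half-open cones partition H
    ([half_open_cone_exists], [half_open_cone_uniq]).

    If T has d edges, k of them pointing away from v, then the lattice points of the t-th dilate in
    its half-open cone are the integral weightings of the edges with total at most t, at least 1 on
    k edges and at least 0 on the rest. There are C(t+d-k, d) of them. Summing over the trees
    ([ehrhart_sep]) gives an expansion of the Ehrhart function in the basis that defines the
    h*-polynomial, and [is_hstar_uniq] identifies the coefficients. *)

(** * Finite minima and nonnegative solutions of least weight *)

Lemma finite_pos_lbound (R : realFieldType) (I : finType) (f : I -> R) :
  (forall i, 0 < f i) -> exists2 d : R, 0 < d & forall i, d <= f i.
Proof.
move=> f_gt0.
exists (\big[Num.min/1]_i f i); last first.
  by move=> i; apply: bigmin_le_cond.
by apply: (big_ind (fun x : R => 0 < x)) => // x y x0 y0; rewrite lt_min x0.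
Qed.

(** Solutions no heavier than [c0] have all entries between 0 and the weight of [c0], so they form a
    compact set, on which the continuous weight attains its minimum. *)
Lemma min_weight (R : realType) (I J : finType) (D : {set I})
    (M : I -> J -> R) (b : J -> R) (c0 : I -> R) :
    (forall i, i \in D -> 0 <= c0 i) ->
    (forall j, \sum_(i in D) c0 i * M i j = b j) ->
  exists c : I -> R,
    [/\ forall i, i \in D -> 0 <= c i,
        forall j, \sum_(i in D) c i * M i j = b j
      & forall c' : I -> R, (forall i, i \in D -> 0 <= c' i) ->
          (forall j, \sum_(i in D) c' i * M i j = b j) ->
          \sum_(i in D) c i <= \sum_(i in D) c' i].
Proof.
move=> c0_ge0 c0E; set W := \sum_(i in D) c0 i.
pose box := [set r : 'rV[R]_#|I| | forall k, `[0, W]%classic (r ord0 k)].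
pose sol j := [set r : 'rV[R]_#|I| |
  \sum_(i in D) r ord0 (enum_rank i) * M i j = b j].
pose wt (r : 'rV[R]_#|I|) : R := \sum_(i in D) r ord0 (enum_rank i).
pose A := box `&` \bigcap_(j in [set: J]) sol j.
have sum_cont (F : I -> 'rV[R]_#|I| -> R) : (forall i, continuous (F i)) ->
    continuous (fun r => \sum_(i in D) F i r).
  by move=> F_cont; apply: continuous_big => //; exact: add_continuous.
have wt_cont : continuous wt by apply: sum_cont => i; exact: coord_continuous.
have box_compact : compact box.
  apply: (@rV_compact _ _ (fun=> `[0, W]%classic)) => _.
  exact: segment_compact.
have A_compact : compact A.
  apply: compact_closedI => //; apply: closed_bigI => j _.
  apply: (@preimage_closed _ _ (fun r : 'rV[R]_#|I| =>
     \sum_(i in D) r ord0 (enum_rank i) * M i j) [set y | y = b j]);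
    last exact: closed_eq.
  move=> r _; move: r; apply: sum_cont => i r.
  apply: (@cvgM _ _ (nbhs r) _ (fun s : 'rV[R]_#|I| => s ord0 (enum_rank i))
    (fun=> M i j)); last exact: cvg_cst.
  exact: coord_continuous.
(* Entries outside [D] are set to 0 so that the vector stays in the box. *)
pose vec (c : I -> R) : 'rV[R]_#|I| :=
  \row_k (if enum_val k \in D then c (enum_val k) else 0).
have vecE c i : i \in D -> vec c ord0 (enum_rank i) = c i.
  by move=> iD; rewrite mxE enum_rankK iD.
have wt_vec c : wt (vec c) = \sum_(i in D) c i.
  by apply: eq_bigr => i iD; rewrite vecE.
have vecA c : (forall i, i \in D -> 0 <= c i) ->
    (forall j, \sum_(i in D) c i * M i j = b j) ->
    \sum_(i in D) c i <= W -> A (vec c).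
  move=> c_ge0 cE cW; split=> [k|j _] /=.
    rewrite in_itv /= mxE; case: ifP => kD; last by rewrite lexx sumr_ge0.
    rewrite c_ge0 //=; apply: le_trans cW.
    by rewrite (bigD1 (enum_val k)) //= lerDl sumr_ge0 // => i /andP[/c_ge0].
  by rewrite /sol /= -(cE j); apply: eq_bigr => i iD; rewrite vecE.
have A0 : A (vec c0) by exact: vecA.
have [|r /set_mem[r_box r_sol] r_min] :=
    compact_EVT_min (ex_intro _ _ A0) A_compact (f := wt).
  exact: continuous_subspaceT.
exists (fun i => r ord0 (enum_rank i)); split=> [i _|j|c c_ge0 cE].
- by have := r_box (enum_rank i); rewrite /= in_itv /= => /andP[].
- exact: r_sol.
(* A competitor heavier than [W] may leave the box, but it already loses against [c0]. *)
have [cW|/ltW Wc] := lerP (\sum_(i in D) c i) W.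
  by rewrite -(wt_vec c); apply: r_min; apply: mem_set; apply: vecA.
apply: le_trans Wc; rewrite -/(wt r) /W -wt_vec.
by apply: r_min; apply: mem_set.
Qed.

(** * Coordinates, edge vectors and the zero-sum hyperplane *)

Section VertexSpace.
Variables (R : realType) (V : finType).
Local Notation RV := (vertex_space R V).
Implicit Types (x y : RV) (u w : V).

Lemma vertex_spaceP x y : (forall u, coordinate x u = coordinate y u) -> x = y.
Proof. by move=> xy; apply/ffunP. Qed.

Lemma coordinate0 u : coordinate (0 : RV) u = 0.
Proof. by rewrite /coordinate ffunE. Qed.

Lemma coordinateD x y u :
  coordinate (x + y) u = coordinate x u + coordinate y u.
Proof. by rewrite /coordinate ffunE. Qed.

Lemma coordinateN x u : coordinate (- x) u = - coordinate x u.
Proof. by rewrite /coordinate ffunE. Qed.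

Lemma coordinateB x y u :
  coordinate (x - y) u = coordinate x u - coordinate y u.
Proof. by rewrite coordinateD coordinateN. Qed.

Lemma coordinateZ (k : R) x u : coordinate (k *: x) u = k * coordinate x u.
Proof. by rewrite /coordinate ffunE. Qed.

Lemma coordinate_sum (I : Type) (r : seq I) (P : pred I) (F : I -> RV) u :
  coordinate (\sum_(i <- r | P i) F i) u = \sum_(i <- r | P i) coordinate (F i) u.
Proof.
apply: (big_morph (fun x : RV => coordinate x u)); last exact: coordinate0.
by move=> x y; exact: coordinateD.
Qed.

Lemma coordinate_basis u w : coordinate (basis_vec R u) w = (w == u)%:R.
Proof. by rewrite /coordinate ffunE. Qed.

Definition sum_over (S : {set V}) x : R := \sum_(u in S) coordinate x u.

Lemma sum_over_is_linear S : linear_for *%R (sum_over S).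
Proof.
move=> k x y; rewrite /sum_over mulr_sumr -big_split /=.
by apply: eq_bigr => u _; rewrite coordinateD coordinateZ.
Qed.

HB.instance Definition _ S :=
  GRing.isLinear.Build R RV R *%R (sum_over S) (sum_over_is_linear S).

Lemma sum_over_basis S u : sum_over S (basis_vec R u) = (u \in S)%:R.
Proof.
rewrite /sum_over (eq_bigr (fun w => (w == u)%:R)) => [|w _]; last first.
  exact: coordinate_basis.
have [uS|uNS] := boolP (u \in S).
  by rewrite (bigD1 u) //= eqxx big1 ?addr0 // => w /andP[_ /negPf->].
by rewrite big1 // => w wS; case: eqP wS => // ->; rewrite (negPf uNS).
Qed.

Definition edge_vec (a : V * V) : RV := basis_vec R a.2 - basis_vec R a.1.

Lemma sum_over_edge S a :
  sum_over S (edge_vec a) = (a.2 \in S)%:R - (a.1 \in S)%:R.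
Proof. by rewrite linearB /= !sum_over_basis. Qed.

Lemma edge_vec_int a u : coordinate (edge_vec a) u \is a Num.int.
Proof. by rewrite coordinateB !coordinate_basis rpredB ?rpred_nat. Qed.

Definition zero_sum x : Prop := sum_over [set: V]%SET x = 0.

Lemma zero_sumD x y : zero_sum x -> zero_sum y -> zero_sum (x + y).
Proof. by rewrite /zero_sum linearD /= => -> ->; rewrite addr0. Qed.

Lemma zero_sumZ k x : zero_sum x -> zero_sum (k *: x).
Proof. by rewrite /zero_sum linearZ /= => ->; rewrite mulr0. Qed.

Lemma zero_sum0 : zero_sum 0.
Proof. by rewrite /zero_sum linear0. Qed.

Lemma zero_sum_sum (I : Type) (r : seq I) (P : pred I) (F : I -> RV) :
  (forall i, P i -> zero_sum (F i)) -> zero_sum (\sum_(i <- r | P i) F i).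
Proof. by move=> F0; rewrite /zero_sum linear_sum /= big1. Qed.

Lemma zero_sum_edge a : zero_sum (edge_vec a).
Proof. by rewrite /zero_sum sum_over_edge !inE subrr. Qed.

Lemma zero_sumE w x : zero_sum x ->
  x = \sum_u coordinate x u *: (basis_vec R u - basis_vec R w).
Proof.
rewrite /zero_sum /sum_over (eq_bigl xpredT) => [x0|u]; last by rewrite inE.
under eq_bigr do rewrite scalerBr; rewrite sumrB -scaler_suml x0 scale0r subr0.
apply: vertex_spaceP => u; rewrite coordinate_sum (bigD1 u) //=.
rewrite coordinateZ coordinate_basis eqxx mulr1 big1 ?addr0 // => i.
by rewrite coordinateZ coordinate_basis eq_sym => /negPf->; rewrite mulr0.
Qed.

End VertexSpace.

Arguments edge_vec R {V} a.

(** * Cuts and flows in an oriented spanning tree *)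

Definition head_side (V : finType) (T : {set V * V}) (a : V * V) : {set V} :=
  [set u | connect (underlying (T :\ a)) a.2 u]%SET.

Section Tree.
Variables (V : finType) (e : rel V) (T : {set V * V}).
Hypotheses (e_irr : irreflexive e) (T_tree : oriented_spanning_tree e T).
Implicit Types a b : V * V.

Lemma underlyingE (D : {set V * V}) x y :
  underlying D x y = ((x, y) \in D) || ((y, x) \in D).
Proof. by []. Qed.

Lemma underlying_sym (D : {set V * V}) : symmetric (underlying D).
Proof. by move=> x y; apply: orbC. Qed.

Lemma head_in_side a : a.2 \in head_side T a.
Proof. by rewrite inE connect0. Qed.

Lemma tail_notin_side a : a \in T -> a.1 \notin head_side T a.
Proof.
have [Te T_asym _ T_acyc] := T_tree; case: a => [t h] aT; rewrite inE /=.
apply/negP=> /connectP[p0 /shortenP[p p_path p_uniq _] t_last].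
have subT : subrel (underlying (T :\ (t, h))) (underlying T).
  by move=> x y /orP[] /setD1P[_ xyT]; rewrite underlyingE xyT ?orbT.
(* A path from head to tail avoiding the edge closes up to a cycle. Acyclicity leaves only lengths 1
   and 2, which irreflexivity and the single orientation of each edge rule out. *)
have /T_acyc : ucycle (underlying T) (h :: p).
  rewrite /ucycle p_uniq andbT /= rcons_path (sub_path subT p_path) /=.
  by rewrite -t_last underlyingE aT.
case: p p_path p_uniq t_last => [|y [|//]] /=.
  by move=> _ _ th _; have := Te _ _ aT; rewrite th e_irr.
rewrite andbT => hy _ ty _; move: hy; rewrite -ty underlyingE !inE /=.
by rewrite (negPf (T_asym _ _ aT)) andbF eqxx.
Qed.

Lemma side_edge a b : b \in T -> b != a ->
  (b.1 \in head_side T a) = (b.2 \in head_side T a).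
Proof.
move=> bT ba; have b12 : underlying (T :\ a) b.1 b.2.
  by case: b bT ba => s t /= bT ba; rewrite underlyingE !inE ba bT.
rewrite !inE; apply/idP/idP => /connect_trans; apply; apply: connect1 => //.
by rewrite underlying_sym.
Qed.

(** Removing an edge leaves exactly two components, one at each endpoint. *)
Lemma points_awayE a v : a \in T -> points_away T v a = (v \notin head_side T a).
Proof.
move=> aT; have [_ _ T_conn _] := T_tree.
have csym : connect_sym (underlying (T :\ a)).
  exact/sym_connect_sym/underlying_sym.
(* The union of the two components is closed under the edges of [T], so by connectedness it is
   everything. *)
pose A := [pred u | connect (underlying (T :\ a)) a.2 u
                  || connect (underlying (T :\ a)) a.1 u].
have A_closed : fingraph.closed (underlying T) A.
  apply: intro_closed; first exact/sym_connect_sym/underlying_sym.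
  move=> x y xy; rewrite !inE => xA.
  have [xy'|] := boolP (underlying (T :\ a) x y).
    by case/orP: xA => /connect_trans/(_ (connect1 xy')) ->; rewrite ?orbT.
  move: xy; rewrite !underlyingE !inE; case: eqP => [<- /=|_].
    by rewrite connect0.
  case: eqP => [<- /=|_]; first by rewrite connect0 orbT.
  by move=> /= ->.
have : v \in A by rewrite -(closed_connect A_closed (T_conn a.2 v)) inE connect0.
rewrite /points_away !inE; case: (boolP (connect _ a.2 v)) => [av _|_ /= ->] //=.
apply/negP; rewrite csym => va; have := tail_notin_side aT.
by rewrite inE (connect_trans av va).
Qed.

Variable R : realType.
Local Notation RV := (vertex_space R V).

(** The net amount that [a] has to carry when a demand [x] of total 0 is routed along the tree:
    everything demanded on the head side passes through [a]. *)
Definition flow a : RV -> R := sum_over (head_side T a).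

(** Every tree edge other than [a] has both ends on the same side of the cut at [a]. So the flows
    are the dual basis of the edge vectors. *)
Lemma flow_edge a b : a \in T -> b \in T -> flow a (edge_vec R b) = (a == b)%:R.
Proof.
move=> aT bT; rewrite /flow sum_over_edge; case: eqVneq => [<-|ab].
  by rewrite head_in_side (negPf (tail_notin_side aT)) subr0.
by rewrite side_edge ?subrr // eq_sym.
Qed.

Lemma flow_combination (c : V * V -> R) a : a \in T ->
  flow a (\sum_(b in T) c b *: edge_vec R b) = c a.
Proof.
move=> aT; rewrite /flow linear_sum (bigD1 a) //= linearZ /= -/(flow a _).
rewrite flow_edge // eqxx mulr1 big1 ?addr0 // => b /andP[bT ba].
by rewrite linearZ /= -/(flow a _) flow_edge // eq_sym (negPf ba) mulr0.
Qed.

(** The vectors satisfying the identity form a subspace containing the tree edges, hence the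
    differences of basis vectors along tree paths, and these span the hyperplane. *)
Lemma tree_decomposition (x : RV) : zero_sum x ->
  x = \sum_(a in T) flow a x *: edge_vec R a.
Proof.
have [_ _ T_conn _] := T_tree.
pose good (y : RV) := y = \sum_(a in T) flow a y *: edge_vec R a.
have good0 : good 0.
  by rewrite /good big1 // => a _; rewrite /flow linear0 scale0r.
have goodD y z : good y -> good z -> good (y + z).
  rewrite /good => {1}-> {1}->; rewrite -big_split /=; apply: eq_bigr => a _.
  by rewrite -scalerDl; congr (_ *: _); rewrite /flow linearD.
have goodZ k y : good y -> good (k *: y).
  rewrite /good => {1}->; rewrite scaler_sumr; apply: eq_bigr => a _.
  by rewrite scalerA; congr (_ *: _); rewrite /flow linearZ.
have goodE b : b \in T -> good (edge_vec R b).
  move=> bT; rewrite /good (bigD1 b) //= flow_edge // eqxx scale1r big1 ?addr0 //.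
  by move=> a /andP[aT /negPf ab]; rewrite flow_edge // ab scale0r.
have goodP w p : path (underlying T) w p ->
    good (basis_vec R (last w p) - basis_vec R w).
  elim: p w => [|u p IHp] w /=; first by rewrite subrr.
  move=> /andP[wu /IHp up]; rewrite -(subrKA (basis_vec R u)); apply: goodD => //.
  case/orP: wu => [/goodE //|/goodE uw].
  by rewrite -opprB -scaleN1r; apply: goodZ.
move=> x0.
have [w _|noV] := pickP (fun _ : V => true); last first.
  by rewrite (_ : x = 0) //; apply: vertex_spaceP => u; have := noV u.
rewrite -/(good x) (zero_sumE w x0).
elim/big_ind: _ => // u _; apply: goodZ.
by have /connectP[p wp ->] := T_conn w u; apply: goodP.
Qed.

End Tree.

(** * Nonnegative combinations of edge vectors and their total weight *)

Section EdgePolytope.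
Variables (R : realType) (V : finType).
Local Notation RV := (vertex_space R V).
Implicit Types (x y : RV) (D : {set V * V}).

Lemma conv_hull_image (I : finType) (D : {set I}) (f : I -> RV) x :
  conv_hull [set f a | a in [set` D]] x <->
  exists c : I -> R, [/\ forall a, a \in D -> 0 <= c a, \sum_(a in D) c a = 1
    & x = \sum_(a in D) c a *: f a].
Proof.
split=> [[n [p [c [pD c_ge0 c1 ->]]]]|[c [c_ge0 c1 ->]]].
  have {pD}/choice[g gP] : forall i, exists a, a \in D /\ f a = p i.
    (* The points of the combination may repeat; the coefficients of all occurrences of one
       generator are added up. *)
    by move=> i; have [a aD <-] := pD i; exists a.
  exists (fun a => \sum_(i | g i == a) c i); split=> [a _||].
  - exact: sumr_ge0.
  - by rewrite -c1 (partition_big g (mem D)) // => i _; have [] := gP i.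
  rewrite (partition_big g (mem D)) /= => [|i _]; last by have [] := gP i.
  apply: eq_bigr => a _; rewrite scaler_suml; apply: eq_bigr => i /eqP <-.
  by have [_ ->] := gP i.
exists #|D|, (fun i => f (enum_val i)), (fun i => c (enum_val i)).
split=> [i|i||].
- by exists (enum_val i) => //; apply: enum_valP.
- by apply/c_ge0/enum_valP.
- by rewrite -c1 [RHS]big_enum_val.
- by rewrite [LHS]big_enum_val.
Qed.

(** Membership in the dilate of the edge polytope by a real factor [s], phrased by weights so that
    it adds and scales without normalization. *)
Definition edge_weighted D (s : R) x : Prop := exists c : V * V -> R,
  [/\ forall a, a \in D -> 0 <= c a, \sum_(a in D) c a = s
    & x = \sum_(a in D) c a *: edge_vec R a].

Lemma edge_polytopeE D x : edge_polytope R D x <-> edge_weighted D 1 x.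
Proof. exact: conv_hull_image. Qed.

Lemma edge_weighted0 D : edge_weighted D 0 0.
Proof.
exists (fun=> 0); split=> //; first by rewrite big1.
by rewrite big1 // => a _; rewrite scale0r.
Qed.

Lemma edge_weightedD D s t x y :
  edge_weighted D s x -> edge_weighted D t y -> edge_weighted D (s + t) (x + y).
Proof.
move=> [c [c_ge0 cs ->]] [c' [c'_ge0 c't ->]]; exists (fun a => c a + c' a).
split=> [a aD||]; first by rewrite addr_ge0 ?c_ge0 ?c'_ge0.
  by rewrite big_split /= cs c't.
by rewrite -big_split /=; apply: eq_bigr => a _; rewrite scalerDl.
Qed.

Lemma edge_weightedZ D k s x :
  0 <= k -> edge_weighted D s x -> edge_weighted D (k * s) (k *: x).
Proof.
move=> k_ge0 [c [c_ge0 cs ->]]; exists (fun a => k * c a).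
split=> [a aD||]; first by rewrite mulr_ge0 ?c_ge0.
  by rewrite -mulr_sumr cs.
by rewrite scaler_sumr; apply: eq_bigr => a _; rewrite scalerA.
Qed.

Lemma edge_weighted_edge D a : a \in D -> edge_weighted D 1 (edge_vec R a).
Proof.
move=> aD; exists (fun b => (b == a)%:R).
split=> [b _||]; first by case: (b == a).
  by rewrite (bigD1 a) //= eqxx big1 ?addr0 // => b /andP[_ /negPf->].
rewrite (bigD1 a) //= eqxx scale1r big1 ?addr0 // => b /andP[_ /negPf->].
by rewrite scale0r.
Qed.

Lemma edge_weighted_ge0 D s x : edge_weighted D s x -> 0 <= s.
Proof. by move=> [c [c_ge0 <- _]]; apply: sumr_ge0. Qed.

Lemma edge_weighted_eq0 D x : edge_weighted D 0 x -> x = 0.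
Proof.
move=> [c [c_ge0 c0 ->]]; apply: big1 => a aD.
by rewrite (psumr_eq0P c_ge0 c0) ?scale0r.
Qed.

Lemma edge_weighted_zero_sum D s x : edge_weighted D s x -> zero_sum x.
Proof.
move=> [c [_ _ ->]]; apply: zero_sum_sum => a _.
by apply: zero_sumZ; apply: zero_sum_edge.
Qed.

                                                                              
                                  
(** The least weight is the gauge of the edge polytope at [x]; that it is attained is what produces
    the boundary point on a ray. *)
Lemma min_edge_weight D s x : edge_weighted D s x ->
  exists2 m, edge_weighted D m x & forall t, edge_weighted D t x -> m <= t.
Proof.
have coordE c : x = \sum_(a in D) c a *: edge_vec R a <-> forall u,
    \sum_(a in D) c a * coordinate (edge_vec R a) u = coordinate x u.
  split=> [-> u|xE]; last apply: vertex_spaceP => u; rewrite ?coordinate_sum.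
    by apply: eq_bigr => a _; rewrite coordinateZ.
  by rewrite -xE; apply: eq_bigr => a _; rewrite coordinateZ.
move=> [c0 [c0_ge0 _ /coordE c0E]].
have [c [c_ge0 /coordE cE c_min]] := min_weight c0_ge0 c0E.
exists (\sum_(a in D) c a); first by exists c.
by move=> t [c' [c'_ge0 <- /coordE/(c_min _ c'_ge0)]].
Qed.

End EdgePolytope.

(** * Interior and boundary of the symmetric edge polytope along rays from 0 *)

Section SymmetricEdgePolytope.
Variables (R : realType) (V : finType) (e : rel V).
Hypotheses (e_sym : symmetric e) (e_conn : connected_graph e).
Hypothesis V_gt1 : (1 < #|V|)%N.
Local Notation RV := (vertex_space R V).
Local Notation P := (symmetric_edge_polytope R e).
Local Notation weighted := (edge_weighted [set a : V * V | e a.1 a.2]%SET).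
Implicit Types x y : RV.

Lemma sepE x : P x <-> weighted 1 x.
Proof.
rewrite -edge_polytopeE /symmetric_edge_polytope /edge_polytope.
rewrite (_ : mkset _ = [set basis_vec R a.2 - basis_vec R a.1 |
  a in [set` [set a : V * V | e a.1 a.2]%SET]]) //.
apply/seteqP; split=> [y [u [w [uw [->|->]]]]|y [[u w] /=]].
- by exists (w, u); rewrite //= inE /= e_sym.
- by exists (u, w); rewrite //= inE.
by rewrite inE /= => uw <-; exists u, w; split=> //; right.
Qed.

Lemma sep_zero_sum x : P x -> zero_sum x.
Proof. by move/sepE; apply: edge_weighted_zero_sum. Qed.

(** A walk from [w] to [u] writes the difference as a telescoping sum of edge vectors. *)
Lemma weighted_basis u w :
  exists m : R, weighted m (basis_vec R u - basis_vec R w).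
Proof.
have /connectP[p wp ->] := e_conn w u.
elim: p w wp => [|t p IHp] w /=.
  by rewrite subrr; exists 0; apply: edge_weighted0.
move=> /andP[wt /IHp[m mP]]; exists (m + 1).
rewrite -(subrKA (basis_vec R t)); apply: edge_weightedD => //.
by apply: (@edge_weighted_edge _ _ _ (w, t)); rewrite inE.
Qed.

Lemma weighted_norm1 : exists2 B : R, 0 < B &
  forall x, zero_sum x ->
    exists2 s, s <= B * \sum_u `|coordinate x u| & weighted s x.
Proof.
have /choice[m mP] : forall p : V * V, exists m : R,
    weighted m (basis_vec R p.1 - basis_vec R p.2).
  by move=> p; apply: weighted_basis.
have m_ge0 p : 0 <= m p by exact: edge_weighted_ge0 (mP p).
have B_ge p : m p <= 1 + \sum_p m p.
  by rewrite (bigD1 p) //= addrCA lerDl addr_ge0 ?sumr_ge0.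
have [w _|noV] := pickP (fun _ : V => true); last first.
  by move: V_gt1; rewrite (eq_card0 noV).
(* This constant is positive and bounds the weight of every difference of two basis vectors at
   once. *)
exists (1 + \sum_p m p); first by rewrite ltr_pwDl ?sumr_ge0.
move=> x x0; rewrite {2}(zero_sumE w x0) mulr_sumr.
elim/big_rec2: _ => [|u s y _ [t ts ty]].
  by exists 0; last exact: edge_weighted0.
have [c0|c0] := lerP 0 (coordinate x u).
  exists (coordinate x u * m (u, w) + t); last first.
    by apply: edge_weightedD => //; apply: edge_weightedZ => //; apply: (mP (u, w)).
  by rewrite lerD // ger0_norm // mulrC; apply: ler_wpM2r.
exists (- coordinate x u * m (w, u) + t); last first.
  apply: edge_weightedD => //; rewrite -opprB scalerN -scaleNr.
  by apply: edge_weightedZ; [rewrite oppr_ge0 ltW | apply: (mP (w, u))].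
rewrite lerD // ltr0_norm // mulrC; apply: ler_wpM2r => //.
by rewrite oppr_ge0 ltW.
Qed.

(** The origin is the midpoint of the two orientations of any edge, and an edge exists because two
    distinct vertices are connected. *)
Lemma sep0 : P 0.
Proof.
have /card_gt1P[u [w [_ _ uw]]] : (1 < #|[set: V]%SET|)%N by rewrite cardsT.
have /connectP[[|t p] /= up wE] := e_conn u w; first by rewrite wE eqxx in uw.
have /andP[ut _] := up.
have edgeP a : e a.1 a.2 -> weighted 1 (edge_vec R a).
  by move=> ea; apply: edge_weighted_edge; rewrite inE.
have half_ge0 : 0 <= 2%:R^-1 :> R by rewrite invr_ge0.
have := edge_weightedD (edge_weightedZ half_ge0 (edgeP (u, t) ut))
  (edge_weightedZ half_ge0 (edgeP (t, u) _)).
rewrite /= e_sym => /(_ ut).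
rewrite -(scalerDr _ (edge_vec R (u, t))) /edge_vec /= subrKA subrr scaler0.
by rewrite !mulr1 -mulr2n -(mulr_natr 2^-1) mulVf ?pnatr_eq0 // => /sepE.
Qed.

Lemma sep_weighted s x : s <= 1 -> weighted s x -> P x.
Proof.
move=> s_le1 sx; have /sepE/(edge_weightedZ (k := 1 - s)) := sep0.
rewrite subr_ge0 scaler0 mulr1 => /(_ s_le1)/(edge_weightedD sx).
by rewrite addr0 addrC subrK => /sepE.
Qed.

Lemma sep_scale k x : 0 <= k <= 1 -> P x -> P (k *: x).
Proof.
move=> /andP[k0 k1] /sepE/(edge_weightedZ k0) kx.
by apply: sep_weighted kx; rewrite mulr1.
Qed.

Lemma sep_nbhs0 : exists2 d : R, 0 < d &
  forall x, zero_sum x -> (forall u, `|coordinate x u| < d) -> P x.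
Proof.
have [B B_gt0 BP] := weighted_norm1.
have V_gt0 : 0 < #|V|%:R :> R by rewrite ltr0n (leq_trans _ V_gt1).
(* With all |V| coordinates below this radius, the weight bound [B] times the 1-norm is at most
   1. *)
exists (B * #|V|%:R)^-1; first by rewrite invr_gt0 mulr_gt0.
move=> x x0 x_small; have [s sB sx] := BP x x0; apply: sep_weighted sx.
apply: le_trans sB _; rewrite -ler_pdivlMl // mulr1.
have -> : B^-1 = \sum_(u : V) (B * #|V|%:R)^-1.
  by rewrite sumr_const -(mulr_natr (B * _)^-1) invfM -mulrA mulVf ?mulr1 ?gt_eqF.
by apply: ler_sum => u _; apply: ltW.
Qed.

Lemma aff_hull_zero_sum (A : set RV) x :
  (forall y, A y -> zero_sum y) -> aff_hull A x -> zero_sum x.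
Proof.
move=> A0 [n [p [c [pA _ ->]]]]; apply: zero_sum_sum => i _.
by apply: zero_sumZ; apply: A0.
Qed.

Lemma norm1_ge x u : `|coordinate x u| <= \sum_w `|coordinate x w|.
Proof. by rewrite (bigD1 u) //= lerDl sumr_ge0. Qed.

Lemma aff_hull_sep x : aff_hull P x <-> zero_sum x.
Proof.
split; first exact/aff_hull_zero_sum/sep_zero_sum.
move=> x0; have [d d_gt0 dP] := sep_nbhs0.
pose M := 1 + \sum_u `|coordinate x u|.
have M_gt0 : 0 < M by rewrite ltr_pwDl ?sumr_ge0.
pose k := d / M; have k_gt0 : 0 < k by rewrite divr_gt0.
(* Here [k *: x] is small enough to lie in [P], and [x] is the affine combination of it and 0 with
   coefficients 1/k and 1 - 1/k. *)
exists 2, (fun i => if i == ord0 then k *: x else 0),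
  (fun i => if i == ord0 then k^-1 else 1 - k^-1); split.
- move=> i; case: ifP => _; last exact: sep0.
  apply: dP => [|u]; first exact: zero_sumZ.
  rewrite coordinateZ normrM gtr0_norm // /k mulrAC -mulrA gtr_pMr //.
  rewrite ltr_pdivrMr // mul1r /M.
  by apply: (le_lt_trans (norm1_ge x u)); rewrite ltrDr.
- by rewrite big_ord_recl big_ord1 /= addrC subrK.
- by rewrite big_ord_recl big_ord1 /= scaler0 addr0 scalerA mulVf ?scale1r ?gt_eqF.
Qed.

Lemma sep_ray_relint s x : 1 < s -> P (s *: x) -> relint P x.
Proof.
move=> s_gt1 Psx; have s_gt0 : 0 < s by apply: lt_trans s_gt1.
have sV : s^-1 < 1 by rewrite invf_lt1.
have sxK : x = s^-1 *: (s *: x) by rewrite scalerA mulVf ?scale1r ?gt_eqF.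
split.
  by rewrite sxK; apply: sep_scale => //; rewrite invr_ge0 (ltW s_gt0) ltW.
have [d d_gt0 dP] := sep_nbhs0.
pose k := 1 - s^-1; have k_gt0 : 0 < k by rewrite subr_gt0.
exists (k * d); first by rewrite mulr_gt0.
move=> y /aff_hull_sep y0 yx.
(* A nearby [y] is the convex combination of (y - x)/k and [s *: x] with coefficients k and 1/s,
   where k = 1 - 1/s. *)
have Pz : P (k^-1 *: (y - x)).
  apply: dP => [|u].
    apply: zero_sumZ; apply: zero_sumD => //; rewrite -scaleN1r; apply: zero_sumZ.
    by rewrite sxK; apply: zero_sumZ; apply: sep_zero_sum.
  rewrite coordinateZ coordinateB normrM gtr0_norm ?invr_gt0 //.
  by rewrite ltr_pdivrMl.
have := edge_weightedD (edge_weightedZ (ltW k_gt0) (proj1 (sepE _) Pz))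
  (edge_weightedZ (k := s^-1) _ (proj1 (sepE _) Psx)).
rewrite invr_ge0 (ltW s_gt0) -sxK scalerA mulfV ?gt_eqF // scale1r subrK.
by rewrite !mulr1 /k subrK => /(_ isT)/sepE.
Qed.

Lemma relint_sep_ray x : relint P x -> exists2 s, 1 < s & P (s *: x).
Proof.
move=> [Px [d d_gt0 dP]]; pose M := 1 + \sum_u `|coordinate x u|.
have M_gt0 : 0 < M by rewrite ltr_pwDl ?sumr_ge0.
have k_gt0 : 0 < d / M by rewrite divr_gt0.
exists (1 + d / M); first by rewrite ltrDl.
apply: dP => [|u]; first by apply/aff_hull_sep/zero_sumZ/sep_zero_sum.
rewrite coordinateZ mulrDl mul1r addrAC subrr add0r normrM gtr0_norm //.
rewrite mulrAC -mulrA gtr_pMr // ltr_pdivrMr // mul1r /M.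
by apply: (le_lt_trans (norm1_ge x u)); rewrite ltrDr.
Qed.

(** Dividing by the least weight [m] of [x] lands in [P]. If this point were relatively interior, it
    could be stretched by some [s] > 1 within [P], giving [x] the smaller weight m/s. *)
Lemma sep_boundary_ray x : zero_sum x -> x != 0 ->
  exists2 s, 0 < s & relboundary P (s *: x).
Proof.
move=> x0 x_neq0.
have [B _ /(_ x x0)[s0 _ /min_edge_weight[m mx m_min]]] := weighted_norm1.
have m_gt0 : 0 < m.
  rewrite lt_def (edge_weighted_ge0 mx) andbT; apply: contraNneq x_neq0 => m0.
  by apply/eqP; apply: (@edge_weighted_eq0 _ _ _ x); rewrite -m0; exact: mx.
exists m^-1; first by rewrite invr_gt0.
split.
  apply/sepE; rewrite -(mulVf (lt0r_neq0 m_gt0)).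
  by apply: edge_weightedZ => //; rewrite invr_ge0 ltW.
move=> /relint_sep_ray[s s_gt1]; have s_gt0 : 0 < s by apply: lt_trans s_gt1.
move=> /sepE/(edge_weightedZ (k := m / s)); rewrite !scalerA.
rewrite -!mulrA mulKf ?gt_eqF // mulfV ?gt_eqF // scale1r mulr1.
move=> /(_ (divr_ge0 (ltW m_gt0) (ltW s_gt0)))/m_min.
by rewrite leNgt ltr_pdivrMr // ltr_pMr // s_gt1.
Qed.

End SymmetricEdgePolytope.

(** * Tree simplices in flow coordinates *)

Section TreeSimplex.
Variables (R : realType) (V : finType) (e : rel V) (T : {set V * V}).
Hypotheses (e_irr : irreflexive e) (T_tree : oriented_spanning_tree e T).
Local Notation RV := (vertex_space R V).
Implicit Types x y : RV.

(** The flows are the barycentric coordinates of the simplex. *)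
Lemma tree_simplexE x : edge_polytope R T x <->
  [/\ zero_sum x, forall a, a \in T -> 0 <= flow T a x
    & \sum_(a in T) flow T a x = 1].
Proof.
rewrite edge_polytopeE; split=> [Tx|[x0 x_ge0 x1]]; last first.
  by exists (fun a => flow T a x); split=> //; apply: tree_decomposition x0.
have x0 := edge_weighted_zero_sum Tx; case: Tx => c [c_ge0 c1 xE].
have flowE a : a \in T -> flow T a x = c a.
  by rewrite xE; apply: (flow_combination e_irr T_tree).
by split=> // [a aT|]; [rewrite flowE ?c_ge0 | rewrite -c1; apply: eq_bigr].
Qed.

Lemma tree_simplex_relint x : zero_sum x ->
    (forall a, a \in T -> 0 < flow T a x) -> \sum_(a in T) flow T a x = 1 ->
  relint (edge_polytope R T) x.
Proof.
move=> x0 x_gt0 x1; split.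
  by apply/tree_simplexE; split=> // a /x_gt0/ltW.
(* The value 1 off the tree only makes the family positive on all pairs. *)
have flow_gt0 a : 0 < if a \in T then flow T a x else 1.
  by case: ifP => // /x_gt0.
have [d d_gt0 dP] := finite_pos_lbound flow_gt0.
have N_gt0 : 0 < #|V|.+1%:R :> R by rewrite ltr0n.
(* A flow is a sum of at most |V| coordinates, so it changes by at most [d], a lower bound for the
   flows of [x]. *)
exists (d / #|V|.+1%:R); first by rewrite divr_gt0.
move=> y Ty yx; apply/tree_simplexE.
split.
- by apply: aff_hull_zero_sum Ty => z /tree_simplexE[].
- move=> a aT; have := dP a; rewrite aT => dle.
  suff : `|flow T a y - flow T a x| <= d by rewrite ler_norml; lra.
  rewrite /flow -linearB /sum_over; apply: le_trans (ler_norm_sum _ _ _) _.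
  apply: (@le_trans _ _ (\sum_(u in head_side T a) d / #|V|.+1%:R)).
    by apply: ler_sum => u _; rewrite coordinateB ltW.
  rewrite sumr_const -(mulr_natr (d / _)) -mulrA ger_pMr // ler_pdivrMl // mulr1.
  by rewrite ler_nat (leq_trans (max_card _)).
case: Ty => n [p [c [pT c1 ->]]].
under eq_bigr => a _ do rewrite /flow linear_sum /=.
rewrite exchange_big /= -c1; apply: eq_bigr => i _.
have /tree_simplexE[_ _ p1] := pT i.
rewrite -[RHS]mulr1 -p1 mulr_sumr; apply: eq_bigr => a _.
by rewrite linearZ.
Qed.

End TreeSimplex.

(** * The half-open decomposition of the zero-sum hyperplane *)

Lemma perturbation_sign (R : realFieldType) (a b d : R) :
    0 < d -> b != 0 -> (a != 0 -> d * `|b| < `|a|) ->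
  a + d * b != 0 /\ (0 < a + d * b) = (if b < 0 then 0 < a else 0 <= a).
Proof.
move=> d_gt0 b_neq0 small.
have [a_lt0|a_gt0|a0] := ltrgtP a 0.
- have := small (ltr0_neq0 a_lt0); rewrite (ltr0_norm a_lt0) -{1}(gtr0_norm d_gt0).
  rewrite -normrM ltr_norml => /andP[lo hi].
  have s_lt0 : a + d * b < 0 by lra.
  by rewrite (ltr0_neq0 s_lt0) (lt_gtF s_lt0); split=> //; case: ifP.
- have := small (lt0r_neq0 a_gt0); rewrite (gtr0_norm a_gt0) -{1}(gtr0_norm d_gt0).
  rewrite -normrM ltr_norml => /andP[lo hi].
  have s_gt0 : 0 < a + d * b by lra.
  by rewrite s_gt0 (lt0r_neq0 s_gt0); split=> //; case: ifP.
rewrite a0 add0r; split; first by rewrite mulf_neq0 // lt0r_neq0.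
by rewrite pmulr_rgt0 //; case: (ltrgtP b 0) b_neq0.
Qed.

Section Dissection.
Variables (R : realType) (V : finType) (e : rel V).
Hypotheses (e_sym : symmetric e) (e_irr : irreflexive e).
Hypotheses (e_conn : connected_graph e) (V_gt1 : (1 < #|V|)%N).
Variable TT : {set {set V * V}}.
Hypothesis TT_dis : dissecting_tree_set R e TT.
Variable v : V.
Local Notation RV := (vertex_space R V).
Local Notation P := (symmetric_edge_polytope R e).
Implicit Types (x y : RV) (T : {set V * V}).

Let TT_tree T : T \in TT -> oriented_spanning_tree e T.
Proof. by have [TT_tree _ _] := TT_dis; apply: TT_tree. Qed.

(** The generic direction of perturbation: its cut sums depend only on the size of the cut and on
    the side containing [v]. *)
Definition source : RV :=
  #|V|%:R *: basis_vec R v - \sum_u basis_vec R u.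

Lemma sum_over_source S : sum_over S source = #|V|%:R * (v \in S)%:R - #|S|%:R.
Proof.
rewrite /source linearB linearZ /= sum_over_basis (linear_sum (sum_over S)) /=.
congr (_ - _).
under eq_bigr do rewrite sum_over_basis.
rewrite -natr_sum -sum1_card; congr (_%:R); rewrite [RHS]big_mkcond.
by apply: eq_bigr => u _; case: (u \in S).
Qed.

Lemma source_zero_sum : zero_sum source.
Proof. by rewrite /zero_sum sum_over_source inE mulr1 cardsT subrr. Qed.

(** If [v] is on the head side S the flow is |V| - |S|, positive since the tail is outside S;
    otherwise it is -|S|, negative since the head is in S. *)
Lemma flow_source T a : oriented_spanning_tree e T -> a \in T ->
  flow T a source != 0 /\ (flow T a source < 0) = points_away T v a.
Proof.
move=> T_tree aT; rewrite (points_awayE e_irr T_tree) // /flow sum_over_source.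
case: (boolP (v \in _)) => vS /=.
  rewrite mulr1 subr_eq0 subr_lt0 ltr_nat eqr_nat; split.
    rewrite -cardsT eqn_leq negb_and -!ltnNge proper_card ?orbT //.
    apply/properP; split; first by apply/fintype.subsetP => u; rewrite inE.
    by exists a.1 => //; apply: (tail_notin_side e_irr T_tree).
  by apply/negbTE; rewrite -leqNgt max_card.
rewrite mulr0 add0r oppr_eq0 oppr_lt0 ltr0n pnatr_eq0 -lt0n.
suff -> : (0 < #|head_side T a|)%N by [].
by apply/card_gt0P; exists a.2; apply: head_in_side.
Qed.

Lemma cone_boundary T y : T \in TT -> zero_sum y ->
    (forall a, a \in T -> 0 <= flow T a y) -> 0 < \sum_(a in T) flow T a y ->
  relboundary P ((\sum_(a in T) flow T a y)^-1 *: y).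
Proof.
move=> TTT y0 y_ge0 s_gt0; have [_ _ <-] := TT_dis; exists T => //.
apply/(tree_simplexE e_irr (TT_tree TTT)); split; first exact: zero_sumZ.
  by move=> a aT; rewrite /flow linearZ /= mulr_ge0 ?y_ge0 // invr_ge0 ltW.
under eq_bigr do rewrite /flow linearZ /=.
by rewrite -mulr_sumr mulVf // gt_eqF.
Qed.

(** The nearer of two points of [P] on a ray from 0 can be stretched within [P], so it is relatively
    interior. *)
Lemma boundary_ray_uniq y (s t : R) : 0 < s -> s < t ->
  relboundary P (s *: y) -> relboundary P (t *: y) -> False.
Proof.
move=> s_gt0 st [_ not_int] [Pt _]; apply: not_int.
apply: (sep_ray_relint e_sym e_conn V_gt1 (s := t / s)).
  by rewrite ltr_pdivlMr // mul1r.
by rewrite scalerA mulrVK // unitfE gt_eqF.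
Qed.

Lemma tree_neq0 T : T \in TT -> exists a, a \in T.
Proof.
(* An empty tree would force [source] to vanish, but its coordinate at [v] is |V| - 1. *)
move=> TTT; apply/set0Pn; apply/eqP => T0.
have := tree_decomposition e_irr (TT_tree TTT) source_zero_sum.
rewrite {1}T0 big_set0 => /(congr1 (sum_over [set v]%SET)).
rewrite sum_over_source inE eqxx mulr1 cards1 linear0 => /eqP.
by rewrite subr_eq0 eqr_nat => /eqP V1; move: V_gt1; rewrite V1.
Qed.

(** Normalizing [y] by either flow total gives a boundary point on the same ray, hence the same
    point; it is in the relative interior of both simplices. *)
Lemma open_cones_disjoint T1 T2 y : T1 \in TT -> T2 \in TT -> zero_sum y ->
    (forall a, a \in T1 -> 0 < flow T1 a y) ->
    (forall a, a \in T2 -> 0 < flow T2 a y) -> T1 = T2.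
Proof.
move=> TT1 TT2 y0 y1 y2; have [_ disj _] := TT_dis.
have s_gt0 T : T \in TT -> (forall a, a \in T -> 0 < flow T a y) ->
    0 < \sum_(a in T) flow T a y.
  move=> TTT y_gt0; have [a aT] := tree_neq0 TTT.
  by rewrite (bigD1 a) //= ltr_pwDl ?y_gt0 // sumr_ge0 // => b /andP[/y_gt0/ltW].
have s1 := s_gt0 _ TT1 y1; have s2 := s_gt0 _ TT2 y2.
have b1 := cone_boundary TT1 y0 (fun a aT => ltW (y1 a aT)) s1.
have b2 := cone_boundary TT2 y0 (fun a aT => ltW (y2 a aT)) s2.
have eq_s : \sum_(a in T1) flow T1 a y = \sum_(a in T2) flow T2 a y.
  apply: invr_inj; case: (ltrgtP (\sum_(a in T1) flow T1 a y)^-1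
      (\sum_(a in T2) flow T2 a y)^-1) => //.
    by move=> s12; exfalso; apply: boundary_ray_uniq s12 b1 b2; rewrite invr_gt0.
  by move=> s21; exfalso; apply: boundary_ray_uniq s21 b2 b1; rewrite invr_gt0.
have [//|/(disj _ _ TT1 TT2)/seteqP[sub0 _]] := eqVneq T1 T2.
have int T : T \in TT -> (forall a, a \in T -> 0 < flow T a y) ->
    relint (edge_polytope R T) ((\sum_(a in T) flow T a y)^-1 *: y).
  move=> TTT y_gt0; have s0 := s_gt0 _ TTT y_gt0.
  apply: (tree_simplex_relint e_irr (TT_tree TTT)); first exact: zero_sumZ.
    by move=> a aT; rewrite /flow linearZ /= mulr_gt0 ?y_gt0 ?invr_gt0.
  under eq_bigr do rewrite /flow linearZ /=.
  by rewrite -mulr_sumr mulVf // gt_eqF.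
case: (sub0 ((\sum_(a in T1) flow T1 a y)^-1 *: y)); split; first exact: int.
by rewrite eq_s; apply: int.
Qed.

(** The points that a small push along [source] moves into the open cone of [T]. *)
Definition half_open_cone T x : Prop := forall a, a \in T ->
  if points_away T v a then 0 < flow T a x else 0 <= flow T a x.

Lemma half_open_ge0 T x a : half_open_cone T x -> a \in T -> 0 <= flow T a x.
Proof. by move=> + aT => /(_ a aT); case: ifP => // _ /ltW. Qed.

Lemma generic_perturbation x : exists2 d : R, 0 < d &
  forall T a, T \in TT -> a \in T ->
    flow T a (x + d *: source) != 0 /\
    (0 < flow T a (x + d *: source)) =
      if points_away T v a then 0 < flow T a x else 0 <= flow T a x.
Proof.
(* Step sizes up to this bound cannot cancel a nonzero flow of [x]; the summand 1 in the denominator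
   makes the inequality strict. *)
pose f (p : {set V * V} * (V * V)) : R :=
  if flow p.1 p.2 x == 0 then 1
  else `|flow p.1 p.2 x| / (1 + `|flow p.1 p.2 source|).
have N_gt0 p : 0 < 1 + `|flow p.1 p.2 source| by rewrite ltr_pwDl.
have f_gt0 p : 0 < f p.
  by rewrite /f; case: eqP => // /eqP xp; rewrite divr_gt0 // normr_gt0.
have [d d_gt0 df] := finite_pos_lbound f_gt0; exists d => // T a TTT aT.
have [q_neq0 <-] := flow_source (TT_tree TTT) aT.
rewrite /flow linearD linearZ /=; apply: perturbation_sign => // x_neq0.
have := df (T, a); rewrite /f /= /flow (negPf x_neq0).
rewrite ler_pdivlMr; last exact: (N_gt0 (T, a)).
by apply: lt_le_trans; rewrite ltr_pM2l // ltrDr.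
Qed.

(** The ray through the perturbed point hits the boundary in some simplex of the dissection. Its
    flows there are nonnegative and, by genericity, nonzero. *)
Lemma half_open_cone_exists x : zero_sum x ->
  exists2 T, T \in TT & half_open_cone T x.
Proof.
move=> x0; have [d d_gt0 dP] := generic_perturbation x.
set y := x + d *: source.
have y0 : zero_sum y by apply: zero_sumD => //; apply/zero_sumZ/source_zero_sum.
have in_cone s : 0 < s -> relboundary P (s *: y) ->
    exists2 T, T \in TT & half_open_cone T x.
  move=> s_gt0; have [_ _ <-] := TT_dis; move=> [T /= TTT].
  move=> /(tree_simplexE e_irr (TT_tree TTT))[_ y_ge0 _].
  exists T => // a aT; have [ya_neq0 <-] := dP T a TTT aT.
  rewrite lt_def ya_neq0 /=; have := y_ge0 a aT.
  by rewrite /flow linearZ /= pmulr_rge0.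
have [y_eq0|y_neq0] := eqVneq y 0; last first.
  by have [s s_gt0] := sep_boundary_ray e_sym e_conn V_gt1 y0 y_neq0; apply: in_cone.
(* The perturbed point is not 0: the ray of [source] shows that some tree exists, and 0 has zero
   flow along its edges, against genericity. *)
have q_neq0 : source != 0.
  apply/eqP => /(congr1 (sum_over [set v]%SET)); rewrite sum_over_source linear0.
  rewrite inE eqxx mulr1 cards1 => /eqP; rewrite subr_eq0 eqr_nat => /eqP V1.
  by move: V_gt1; rewrite V1.
have [s _] := sep_boundary_ray e_sym e_conn V_gt1 source_zero_sum q_neq0.
have [_ _ <-] := TT_dis; move=> [T /= TTT _]; have [a aT] := tree_neq0 TTT.
by have [] := dP T a TTT aT; rewrite -/y y_eq0 /flow linear0 eqxx.
Qed.

Lemma half_open_cone_uniq T1 T2 x : T1 \in TT -> T2 \in TT -> zero_sum x ->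
  half_open_cone T1 x -> half_open_cone T2 x -> T1 = T2.
Proof.
move=> TT1 TT2 x0 x1 x2; have [d d_gt0 dP] := generic_perturbation x.
apply: (@open_cones_disjoint _ _ (x + d *: source)) => //.
- by apply: zero_sumD => //; apply/zero_sumZ/source_zero_sum.
- by move=> a aT; have [_ ->] := dP T1 a TT1 aT; apply: x1.
- by move=> a aT; have [_ ->] := dP T2 a TT2 aT; apply: x2.
Qed.

(** On the cone of [T] the total flow is the gauge of [P], because dividing by it gives a boundary
    point. *)
Lemma dilate_sepE T x (t : nat) : T \in TT -> zero_sum x ->
    (forall a, a \in T -> 0 <= flow T a x) ->
  dilate t P x <-> \sum_(a in T) flow T a x <= t%:R.
Proof.
move=> TTT x0 x_ge0; set s := \sum_(a in T) _.
have s_ge0 : 0 <= s by apply: sumr_ge0.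
have [s_eq0|s_neq0] := eqVneq s 0.
  rewrite s_eq0; split=> // _; exists 0; first exact: sep0.
  rewrite scaler0 (tree_decomposition e_irr (TT_tree TTT) x0) big1 // => a aT.
  by rewrite (psumr_eq0P x_ge0 s_eq0) ?scale0r.
have s_gt0 : 0 < s by rewrite lt_def s_neq0.
have [Ps s_bd] := cone_boundary TTT x0 x_ge0 s_gt0.
split=> [[p Pp xE]|st].
  (* The dilate by 0 contains only 0, whose total flow is 0. *)
  case: t xE => [|t] xE.
    by move: s_gt0; rewrite /s -xE scale0r big1 ?ltxx // => a _; rewrite /flow linear0.
  rewrite leNgt; apply/negP => ts; apply: s_bd.
  apply: (sep_ray_relint e_sym e_conn V_gt1 (s := s / t.+1%:R)).
    by rewrite ltr_pdivlMr ?mul1r ?ltr0n.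
  by rewrite -/s -xE !scalerA mulrAC divfK ?pnatr_eq0 // mulfV // scale1r.
have t_gt0 : 0 < t%:R :> R by apply: lt_le_trans st.
exists (t%:R^-1 *: x); last by rewrite scalerA mulfV ?scale1r ?gt_eqF.
have -> : t%:R^-1 *: x = (s / t%:R) *: (s^-1 *: x).
  by rewrite scalerA mulrAC mulfV // mul1r.
apply: sep_scale => //; rewrite divr_ge0 ?(ltW t_gt0) //=.
by rewrite ler_pdivrMr ?mul1r.
Qed.

End Dissection.

(** * Uniqueness of the dimension and of the h*-polynomial *)

Section HstarUniqueness.
Variables (R : realType) (V : finType).
Local Notation RV := (vertex_space R V).
Implicit Types (A : set RV) (h : {poly R}).

Lemma has_dim_uniq A d d' : has_dim A d -> has_dim A d' -> d = d'.
Proof.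
move=> [x [U [<- AE]]] [x' [U' [<- AE']]].
have sub (y y' : RV) (W W' : {vspace RV}) :
    [set y + w | w in [set` W]] = [set y' + w | w in [set` W']] -> (W <= W')%VS.
  move=> WE; apply/subvP => w wW.
  have [w1 w1W' yE] : [set y' + w | w in [set` W']] y.
    by rewrite -WE; exists 0; rewrite /= ?mem0v ?addr0.
  have [w2 w2W' ywE] : [set y' + w | w in [set` W']] (y + w).
    by rewrite -WE; exists w.
  have -> : w = w2 - w1.
    by rewrite -[w](addKr y) -ywE -yE opprD addrACA addNr add0r addrC.
  exact: rpredB.
have UU' : [set x + w | w in [set` U]] = [set x' + w | w in [set` U']].
  by rewrite -AE -AE'.
by apply/eqP; rewrite eqn_leq !dimvS //; [exact: sub (esym UU') | exact: sub UU'].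
Qed.

                                                                           
                                     
(** Evaluating at t = k gives a triangular system: the k-th binomial is 1 and those with larger
    index vanish. *)
Lemma binomial_basis_inj (d : nat) (f : nat -> R) :
  (forall t : nat, \sum_(k < d.+1) f k * 'C(t + d - k, d)%:R = 0) ->
  forall k, (k <= d)%N -> f k = 0.
Proof.
move=> f0 k; elim/ltn_ind: k => k IHk kd.
have := f0 k; rewrite (bigD1 (Ordinal (kd : (k < d.+1)%N))) //=.
rewrite addKn binn mulr1 big1 ?addr0 // => j jk.
have [jltk|] := ltnP j k; first by rewrite IHk ?mul0r // ltnW // (leq_trans jltk).
rewrite leq_eqVlt => /orP[/eqP kj|kj]; first by case/eqP: jk; apply: val_inj.
rewrite bin_small ?mulr0 // ltn_subLR ?ltn_add2r //.
by rewrite (leq_trans (leq_ord j)) ?leq_addl.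
Qed.

Lemma is_hstar_uniq A h h' : is_hstar A h -> is_hstar A h' -> h = h'.
Proof.
move=> [d [Ad hd hE]] [d' [Ad' hd' hE']]; move: hd' hE'.
rewrite -{d' Ad'}(has_dim_uniq Ad Ad') => hd' hE'.
apply/polyP => k; have [kd|dk] := leqP k d; last first.
  by rewrite !nth_default // (leq_trans _ dk).
apply/eqP; rewrite -subr_eq0; apply/eqP.
apply: (binomial_basis_inj (f := fun k => h`_k - h'`_k)) kd => t.
under eq_bigr do rewrite mulrBl.
by rewrite sumrB -hE -hE' subrr.
Qed.

Lemma hstarE A h : is_hstar A h -> hstar A = h.
Proof.
move=> Ah; apply: is_hstar_uniq (Ah).
exact: (xgetPex 0 (ex_intro (is_hstar A) h Ah)).
Qed.

End HstarUniqueness.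

(** * Counting tuples of bounded sum *)

(** No entry exceeds the sum, so the bound [N] on the entries may be replaced by [m], where
    [card_partial_ord_partitions] applies. *)
Lemma card_bounded_sum_tuples (d N m : nat) : (m <= N)%N ->
  #|[set s : d.-tuple 'I_N.+1 | (\sum_(i <- s) i <= m)%N]%SET| = 'C(m + d, d).
Proof.
move=> mN; rewrite addnC -card_partial_ord_partitions.
have mN1 : (m.+1 <= N.+1)%N by [].
pose f (s : d.-tuple 'I_m.+1) : d.-tuple 'I_N.+1 :=
  [tuple of map (widen_ord mN1) s].
have sum_f s : (\sum_(i <- f s) i = \sum_(i <- s) i)%N by rewrite big_map.
have f_inj : injective f.
  move=> s s' /(congr1 val) /= ss'; apply: val_inj; apply: inj_map ss'.
  by move=> i j /(congr1 val) ij; apply: val_inj.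
rewrite -(card_imset _ f_inj); apply: eq_card => s; rewrite inE.
apply/idP/imsetP => [sm|[s' s'P ->]]; last by rewrite sum_f; rewrite inE in s'P.
have le_m i : i \in s -> (i <= m)%N.
  by move=> i_s; apply: leq_trans sm; rewrite (big_rem i) //= leq_addr.
have fsE : s = f [tuple of map (fun i : 'I_N.+1 => inord i) s].
  apply: val_inj; rewrite /= -map_comp -[LHS]map_id; apply/eq_in_map => i /le_m im.
  by apply: val_inj; rewrite /= inordK.
by exists [tuple of map (fun i : 'I_N.+1 => inord i) s]; rewrite // inE -sum_f -fsE.
Qed.

Lemma map_nth_index (A : eqType) (B : Type) (b : B) (s : seq A) (r : seq B) :
  uniq s -> size s = size r -> [seq nth b r (index x s) | x <- s] = r.
Proof.
move=> s_uniq sr; apply: (@eq_from_nth _ b); rewrite size_map // => i i_lt.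
have [x0] : exists x0 : A, True by case: (s) i_lt => // x0; exists x0.
by move=> _; rewrite (nth_map x0) // index_uniq.
Qed.

Lemma card_fset_set_image (A : finType) (B : choiceType) (D : {set A})
    (f : A -> B) :
  {in D &, injective f} -> #|` fset_set [set f x | x in [set` D]]| = #|D|.
Proof.
move=> f_inj.
rewrite (_ : [set f x | x in [set` D]] = [set` [fset f x | x in D]%fset]).
  by rewrite set_fsetK card_in_imfset //= cardE.
apply/seteqP; split=> [y [x xD <-]|y /= /imfsetP[x xD ->]]; last by exists x.
by apply/imfsetP; exists x.
Qed.

(** * The number of tree edges as the dimension of the hyperplane *)

Section TreeDimension.
Variables (R : realType) (V : finType) (e : rel V) (T : {set V * V}).
Hypotheses (e_irr : irreflexive e) (T_tree : oriented_spanning_tree e T).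
Local Notation RV := (vertex_space R V).

Lemma zero_sum_vspace : exists2 U : {vspace RV}, \dim U = #|T| &
  forall x, x \in U <-> zero_sum x.
Proof.
pose X := [tuple edge_vec R (enum_val i) | i < #|T|].
have XE (k : 'I_#|T| -> R) : \sum_i k i *: X`_i
    = \sum_(i < #|T|) k i *: edge_vec R (enum_val i).
  by apply: eq_bigr => i _; rewrite -tnth_nth tnth_mktuple.
exists <<X>>%VS.
  suff /eqP -> : free X by rewrite size_tuple.
  apply/freeP => k; rewrite XE => k0 i.
  (* The coefficients are reindexed by edges so that a flow can read off each of them from the
     vanishing combination. *)
  pose c (a : V * V) : R := k (enum_rank_in (enum_valP i) a).
  have cE j : c (enum_val j) = k j by rewrite /c enum_valK_in.
  rewrite -cE -(flow_combination e_irr T_tree c (enum_valP i))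
    big_enum_val /=.
  under eq_bigr do rewrite cE.
  by rewrite k0 /flow linear0.
move=> x; split=> [/coord_span ->|x0].
  rewrite XE; apply: zero_sum_sum => i _.
  by apply: zero_sumZ; apply: zero_sum_edge.
rewrite (tree_decomposition e_irr T_tree x0); apply: rpred_sum => a aT.
apply: rpredZ; apply: memv_span; apply/tnthP; exists (enum_rank_in aT a).
by rewrite tnth_mktuple enum_rankK_in.
Qed.

End TreeDimension.

(** * Lattice points of dilates, tree by tree *)

Section LatticePoints.
Variables (R : realType) (V : finType) (e : rel V).
Hypotheses (e_sym : symmetric e) (e_irr : irreflexive e).
Hypotheses (e_conn : connected_graph e) (V_gt1 : (1 < #|V|)%N).
Variable TT : {set {set V * V}}.
Hypothesis TT_dis : dissecting_tree_set R e TT.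
Variables (v : V) (d : nat).
Hypothesis card_tree : forall T, T \in TT -> #|T| = d.
Local Notation RV := (vertex_space R V).
Local Notation P := (symmetric_edge_polytope R e).
Implicit Types (x y : RV) (T : {set V * V}).

Let TT_tree T : T \in TT -> oriented_spanning_tree e T.
Proof. by have [TT_tree _ _] := TT_dis; apply: TT_tree. Qed.

Variable t : nat.

                                                                        
                                                       
(** The tuple lists the excess of each weight over its lower bound, which is 1 on edges pointing
    away from [v] and 0 on the others. *)
Definition cone_weight T (s : d.-tuple 'I_t.+1) (a : V * V) : nat :=
  nth 0%N (map val s) (index a (enum T)) + points_away T v a.

Definition cone_point (p : {set V * V} * d.-tuple 'I_t.+1) : RV :=
  \sum_(a in p.1) (cone_weight p.1 p.2 a)%:R *: edge_vec R a.

Definition cone_codes : {set {set V * V} * d.-tuple 'I_t.+1} :=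
  [set p : {set V * V} * d.-tuple 'I_t.+1 |
    (p.1 \in TT) && (\sum_(i <- p.2) i + num_away p.1 v <= t)%N]%SET.

Lemma cone_weight_sum T s : T \in TT ->
  (\sum_(a in T) cone_weight T s a = \sum_(i <- s) i + num_away T v)%N.
Proof.
move=> TTT; rewrite big_split /=; congr (_ + _)%N; last first.
  rewrite /num_away -sum1_card big_mkcond [RHS]big_mkcond /=.
  by apply: eq_bigr => a _; rewrite inE; case: (a \in T).
rewrite -big_enum /= -(big_map (fun a => nth 0%N (map val s) (index a (enum T)))
  xpredT id) map_nth_index ?enum_uniq ?big_map //.
by rewrite -cardE card_tree // size_map size_tuple.
Qed.

Lemma flow_cone_point T s a : T \in TT -> a \in T ->
  flow T a (cone_point (T, s)) = (cone_weight T s a)%:R.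
Proof.
by move=> TTT aT; rewrite (flow_combination e_irr (TT_tree TTT) (fun b => _%:R)).
Qed.

Lemma cone_point_zero_sum p : zero_sum (cone_point p).
Proof.
apply: zero_sum_sum => a _; apply: zero_sumZ; exact: zero_sum_edge.
Qed.

Lemma cone_point_half_open T s : T \in TT ->
  half_open_cone v T (cone_point (T, s)).
Proof.
move=> TTT a aT; rewrite flow_cone_point // /cone_weight.
by case: (points_away T v a); rewrite ?ler0n // addn1 ltr0n.
Qed.

(** The point determines the tree, since half-open cones are disjoint, and then its flows determine
    the tuple. *)
Lemma cone_point_inj : {in cone_codes &, injective cone_point}.
Proof.
move=> [T s] [T' s'] /[!inE] /= /andP[TTT _] /andP[TTT' _] eq_pt.
have TT' : T = T'.
  apply: (half_open_cone_uniq e_sym e_irr e_conn V_gt1 TT_dis TTT TTT'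
    (cone_point_zero_sum (T, s)) (cone_point_half_open s TTT)).
  by rewrite eq_pt; apply: cone_point_half_open.
rewrite -{T' TTT'}TT' in eq_pt *; congr (_, _); apply: val_inj.
apply: (inj_map val_inj).
have size_s (r : d.-tuple 'I_t.+1) : size (enum T) = size (map val r).
  by rewrite -cardE card_tree // size_map size_tuple.
rewrite -[LHS](map_nth_index 0%N (enum_uniq T) (size_s s)).
rewrite -[RHS](map_nth_index 0%N (enum_uniq T) (size_s s')).
apply/eq_in_map => a; rewrite mem_enum => aT.
have /eqP := flow_cone_point s TTT aT; rewrite eq_pt flow_cone_point //.
by rewrite eqr_nat eqn_add2r => /eqP.
Qed.

(** A flow is a sum of coordinates, hence an integer at an integral point; conversely, integral
    weights on integral edge vectors give integral points. *)
Lemma lattice_points :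
  dilate t P `&` @integral_point R V =
    [set cone_point p | p in [set` cone_codes]].
Proof.
apply/seteqP; split=> [x [tPx x_int]|_ [[T s] /= + <-]]; last first.
  rewrite inE /= => /andP[TTT st].
  have flow_ge0 a : a \in T -> 0 <= flow T a (cone_point (T, s)).
    by move=> aT; rewrite flow_cone_point.
  split.
    apply/(dilate_sepE e_sym e_irr e_conn V_gt1 TT_dis t TTT
      (cone_point_zero_sum (T, s)) flow_ge0).
    rewrite (eq_bigr (fun a => (cone_weight T s a)%:R)) => [|a aT]; last first.
      by rewrite flow_cone_point.
    by rewrite -natr_sum ler_nat cone_weight_sum.
  move=> u; rewrite coordinate_sum rpred_sum // => a _.
  by rewrite coordinateZ rpredM ?edge_vec_int ?rpred_nat.
have x0 : zero_sum x.
  by have [p Pp <-] := tPx; apply/zero_sumZ/(sep_zero_sum e_sym Pp).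
have [T TTT Tx] := half_open_cone_exists e_sym e_irr e_conn V_gt1 TT_dis v x0.
have flow_nat a : a \in T -> exists n : nat, flow T a x = n%:R.
  move=> aT; apply/natrP; rewrite natrEint (half_open_ge0 Tx aT) andbT.
  by apply: rpred_sum => u _; apply: x_int.
have {flow_nat}/choice[w wP] : forall a,
    exists n : nat, a \in T -> flow T a x = n%:R.
  move=> a; case: (boolP (a \in T)) => [/flow_nat[n nP]|_]; last by exists 0%N.
  by exists n.
have w_sum : (\sum_(a in T) w a <= t)%N.
  rewrite -(ler_nat R) natr_sum.
  have /(dilate_sepE e_sym e_irr e_conn V_gt1 TT_dis t TTT x0
    (fun a => half_open_ge0 Tx (a := a))) := tPx.
  by rewrite (eq_bigr _ (fun a aT => wP a aT)).
have w_away a : a \in T -> (points_away T v a <= w a)%N.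
  move=> aT; have := Tx a aT; rewrite wP //; case: (points_away T v a) => //.
  by rewrite ltr0n.
(* Each weight is at most [t], so [inord] does not truncate. *)
pose s : d.-tuple 'I_t.+1 := [tuple
  inord (let a := nth (v, v) (enum T) i in w a - points_away T v a) | i < d].
have weightE a : a \in T -> cone_weight T s a = w a.
  move=> aT; have ia : (index a (enum T) < d)%N.
    by rewrite -(card_tree TTT) cardE index_mem mem_enum.
  rewrite /cone_weight (nth_map ord0) ?size_tuple //.
  rewrite -[index _ _]/(val (Ordinal ia)) -tnth_nth tnth_mktuple /=.
  rewrite nth_index ?mem_enum //.
  rewrite inordK ?subnK ?w_away // ltnS (leq_trans (leq_subr _ _)) //.
  by apply: leq_trans w_sum; rewrite (bigD1 a) //= leq_addr.
exists (T, s).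
  rewrite /mkset inE; apply/andP; split=> //; apply: leq_trans w_sum.
  by rewrite -(eq_bigr _ weightE) cone_weight_sum.
rewrite [RHS](tree_decomposition e_irr (TT_tree TTT) x0).
by apply: eq_bigr => a aT; rewrite wP //= weightE.
Qed.

Lemma ehrhart_sep :
  ehrhart P t = (\sum_(T in TT) 'C(t + d - num_away T v, d))%N.
Proof.
rewrite /ehrhart lattice_points (card_fset_set_image cone_point_inj).
rewrite -sum1_card (eq_bigl (fun p : {set V * V} * d.-tuple 'I_t.+1 =>
    (p.1 \in TT) && (\sum_(i <- p.2) i + num_away p.1 v <= t)%N)) => [|p];
  last by rewrite inE.
rewrite -(pair_big_dep (fun T => T \in TT)
  (fun T (s : d.-tuple 'I_t.+1) => (\sum_(i <- s) i + num_away T v <= t)%N)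
  (fun _ _ => 1%N)) /=.
apply: eq_bigr => T TTT; have [At|tA] := leqP (num_away T v) t.
  rewrite -addnBAC // -(card_bounded_sum_tuples _ (leq_subr (num_away T v) t)).
  rewrite -sum1_card.
  by apply: eq_bigl => s; rewrite inE leq_subRL // addnC.
(* With more than [t] edges pointing away no code exists, and the binomial vanishes because at most
   [d] edges point away. *)
rewrite bin_small.
  by rewrite big_pred0 // => s; apply/negbTE; rewrite -ltnNge ltn_addl.
rewrite ltn_subLR ?ltn_add2r // -(card_tree TTT) (leq_trans _ (leq_addl _ _)) //.
by apply/subset_leq_card/fintype.subsetP => a; rewrite inE => /andP[].
Qed.

End LatticePoints.

(** * Reading off the coefficients of the h*-polynomial *)

Theorem theorem1p1 (R : realType) (V : finType) (e : rel V)
    (e_sym : symmetric e) (e_irr : irreflexive e)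
    (e_conn : connected_graph e) (V_gt1 : (1 < #|V|)%N)
    (TT : {set {set V * V}}) (TT_dis : dissecting_tree_set R e TT)
    (v : V) (i : nat) :
  (hstar (symmetric_edge_polytope R e))`_i
    = #|[set T in TT | num_away T v == i]%SET|%:R.
Proof.
have [TT_tree _ _] := TT_dis.
have [T0 TT0 _] := half_open_cone_exists e_sym e_irr e_conn V_gt1 TT_dis v
  (zero_sum0 R V).
have [U dimU UP] := zero_sum_vspace R e_irr (TT_tree _ TT0).
(* Both numbers are the dimension of the zero-sum hyperplane, which is also the dimension of the
   polytope. *)
have card_tree T : T \in TT -> #|T| = #|T0|.
  move=> /TT_tree/(zero_sum_vspace R e_irr)[W <- WP]; rewrite -dimU.
  by congr (\dim _); apply/vspaceP => x; apply/idP/idP => [/WP/UP|/UP/WP].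
have away_le T : T \in TT -> (num_away T v <= #|T0|)%N.
  move=> /card_tree <-; apply/subset_leq_card/fintype.subsetP => a.
  by rewrite inE => /andP[].
(* The candidate is the generating polynomial of the trees by the number of edges pointing away from
   [v]; its i-th coefficient is the required count. *)
rewrite (hstarE (h := \sum_(T in TT) 'X^(num_away T v))).
  rewrite coef_sum -sum1_card natr_sum big_mkcond [RHS]big_mkcond /=.
  apply: eq_bigr => T _; rewrite inE coefXn eq_sym.
  by case: (T \in TT) => //=; case: eqP.
exists #|T0|; split.
- exists 0, U; split=> //; apply/seteqP; split=> [x|_ [x + <-]].
    by move=> /(aff_hull_sep e_sym e_conn V_gt1)/UP xU; exists x; rewrite ?add0r.
  by rewrite add0r => /UP/(aff_hull_sep e_sym e_conn V_gt1).
- apply: (leq_trans (size_sum _ _ _)); apply/bigmax_leqP => T TTT.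
  by rewrite size_polyXn ltnS away_le.
move=> t; rewrite (ehrhart_sep e_sym e_irr e_conn V_gt1 TT_dis v card_tree) natr_sum.
under [RHS]eq_bigr do rewrite coef_sum mulr_suml.
(* For a fixed tree only the index k = [num_away T v] contributes, with the binomial found in
   [ehrhart_sep]. *)
rewrite exchange_big /=; apply: eq_bigr => T TTT.
rewrite (bigD1 (Ordinal (away_le T TTT : (num_away T v < #|T0|.+1)%N))) //=.
rewrite coefXn eqxx mul1r big1 ?addr0 // => k kT.
by rewrite coefXn (_ : (_ == _) = false) ?mul0r //; apply/negbTE.
Qed.
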